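(* Let $G$ be a connected graph of order $n\geq 3$ with $|E(G)|\geq\binom{n-2}{2}+2$. Then $prc(G)=\chi'(G)$, or $G$ is isomorphic to one of $P_4$, $Z_2$, $G_{6.3}$.
   Context: A path in an edge-coloured graph is a rainbow path if its edges receive pairwise distinct colours. The proper rainbow connection number $prc(G)$ of a connected graph is the minimum number of colours in a proper edge-colouring (adjacent edges get distinct colours) such that every two distinct vertices are joined by a rainbow path; $\chi'(G)$ is the chromatic index. $P_4$ is the path on 4 vertices. $Z_2$ is the graph on vertices $a,b,c,d,e$ with edges $ab,bc,ca,ad,de$ (a triangle with a pendant path of length 2 attached at one triangle vertex). $G_{6.3}$ is the graph on vertices $w,w_1,w_2,w_3,u_1,u_2$ with the 8 edges $ww_1, ww_2, ww_3, w_2w_3, w_2u_2, u_1u_2, w_1u_1, w_1u_2$. *)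

(* Defs.v *)
From mathcomp Require Import all_boot.
Set Implicit Arguments. Unset Strict Implicit. Unset Printing Implicit Defensive.

(* A simple graph: vertex type T : finType, adjacency e : rel T,
   assumed symmetric and irreflexive (hypotheses in the theorem). *)

Section Graphs.
Variables (T : finType) (e : rel T).

Definition edges : {set {set T}} :=
  [set A : {set T} | [exists x, exists y, e x y && (A == [set x; y])]].

Definition connected_graph : Prop := forall x y : T, connect e x y.

Definition colouring_with (c : {set T} -> nat) (k : nat) : Prop :=
  forall A, A \in edges -> c A < k.

Definition proper_colouring (c : {set T} -> nat) : Prop :=
  forall A B, A \in edges -> B \in edges -> A != B ->
    A :&: B != set0 -> c A != c B.

Definition rainbow_path (c : {set T} -> nat) (u v : T) : Prop :=
  exists p : seq T,
    [&& path e u p, last u p == v, uniq (u :: p) &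
        uniq [seq c [set xy.1; xy.2] | xy <- zip (u :: p) p]].

Definition rainbow_connected (c : {set T} -> nat) : Prop :=
  forall u v : T, u != v -> rainbow_path c u v.

Definition is_chromatic_index (k : nat) : Prop :=
  (exists c, colouring_with c k /\ proper_colouring c) /\
  (forall k' c, colouring_with c k' -> proper_colouring c -> k <= k').

Definition is_prc (k : nat) : Prop :=
  (exists c, [/\ colouring_with c k, proper_colouring c & rainbow_connected c]) /\
  (forall k' c, colouring_with c k' -> proper_colouring c ->
     rainbow_connected c -> k <= k').

End Graphs.

Definition graph_iso (T T' : finType) (e : rel T) (e' : rel T') : Prop :=
  exists f : T -> T', bijective f /\ forall x y, e' (f x) (f y) = e x y.

Definition rel_of_list (n : nat) (l : seq (nat * nat)) : rel 'I_n :=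
  fun x y => ((val x, val y) \in l) || ((val y, val x) \in l).
Arguments rel_of_list : clear implicits.

Definition P4 : rel 'I_4 := rel_of_list 4 [:: (0,1); (1,2); (2,3)].

(* Z_2: a=0, b=1, c=2, d=3, e=4; edges ab, bc, ca, ad, de *)
Definition Z2 : rel 'I_5 := rel_of_list 5 [:: (0,1); (1,2); (2,0); (0,3); (3,4)].

(* G_{6.3}: w=0, w1=1, w2=2, w3=3, u1=4, u2=5;
   edges ww1, ww2, ww3, w2w3, w2u2, u1u2, w1u1, w1u2 *)
Definition G63 : rel 'I_6 :=
  rel_of_list 6 [:: (0,1); (0,2); (0,3); (2,3); (2,5); (4,5); (1,4); (1,5)].

(* Main.v *)
Require Import Defs.
From mathcomp Require Import all_boot zify.
From Stdlib Require Import Classical.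
Set Implicit Arguments. Unset Strict Implicit. Unset Printing Implicit Defensive.

(* In a proper colouring every path of length two is rainbow, so only pairs u, v at distance
   at least three can be bad. If u-x-y-v is never rainbow, then c(ux) = c(yv) for all edges
   xy from N(u) to N(v), so these edges form a matching. With a = |N(u)| <= b = |N(v)|, the
   edge bound leaves at most a + b - 2 missing pairs off {u, v}, while the matching already
   forces ab - a of them; hence (a - 1)(b - 2) <= 0, the counts are equal when a = 1 or
   a = b = 2, and G is determined: all other pairs off {u, v} are adjacent.
   - a = b = 2: rainbow paths of length four exist unless G is G_{6.3}.
   - a = 1, N(u) = {p}, with pq the unique edge from p to N(v): if b >= 3 some path u-p-q-y-v
     is rainbow; if b = 2 and G is not Z_2, a colour free at p is given to up; if b = 1 and G
     is not P_4, then G is a complete graph with two pendant edges, coloured explicitly. *)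

Lemma exists_least (P : nat -> Prop) :
  (exists n, P n) -> exists n, P n /\ forall m, P m -> n <= m.
Proof.
case=> n; elim/ltn_ind: n => n IHn Pn.
have [[m [mn Pm]]|no] := classic (exists m, m < n /\ P m); first exact: IHn mn Pm.
exists n; split=> // m Pm; rewrite leqNgt; apply/negP=> mn; apply: no.
by exists m.
Qed.

Section Graph.
Variables (T : finType) (e : rel T).
Hypotheses (e_sym : symmetric e) (e_irr : irreflexive e).

Local Notation N x := [set y | e x y].
Local Notation col c x y := (c [set x; y]).

(** * Edges as two-element sets, and proper colourings *)

Lemma adj_neq x y : e x y -> x != y.
Proof. by apply: contraTneq => ->; rewrite e_irr. Qed.

Lemma mem_edges x y : e x y -> [set x; y] \in edges e.
Proof.
by move=> exy; rewrite inE; apply/existsP; exists x; apply/existsP; exists y; rewrite exy eqxx.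
Qed.

Lemma edge_at (A : {set T}) x :
  A \in edges e -> x \in A -> exists2 y, e x y & A = [set x; y].
Proof.
rewrite inE => /existsP[a /existsP[b /andP[eab /eqP->]]].
rewrite !inE => /orP[]/eqP->; first by exists b.
by exists a; rewrite 1?e_sym // setUC.
Qed.

Lemma edgeP (A : {set T}) :
  A \in edges e -> exists x y, e x y /\ A = [set x; y].
Proof.
by rewrite inE => /existsP[a /existsP[b /andP[eab /eqP->]]]; exists a, b.
Qed.

Lemma set2_injr (x y z : T) : [set x; y] = [set x; z] -> y = z.
Proof.
move=> E; have := set22 x y; rewrite E !inE => /orP[/eqP yx|/eqP//].
by have := set22 x z; rewrite -E yx !inE orbb => /eqP.
Qed.

(** A vertex shared by two edges can be named first in both, so properness is a condition at single
    vertices. *)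
Lemma properP c :
  proper_colouring e c <->
  (forall x y z, e x y -> e x z -> y != z -> col c x y != col c x z).
Proof.
split=> [pc x y z exy exz yz|pc A B Ae Be AB /set0Pn[x]].
  apply: pc; rewrite ?mem_edges //; first by apply: contraNneq yz => /set2_injr->.
  by apply/set0Pn; exists x; rewrite !inE eqxx.
rewrite inE => /andP[xA xB].
have [y exy defA] := edge_at Ae xA; have [z exz defB] := edge_at Be xB.
by rewrite defA defB in AB *; apply: pc => //; apply: contraNneq AB => ->.
Qed.

Lemma leq_degree_colours c k x :
  colouring_with e c k -> proper_colouring e c -> #|N x| <= k.
Proof.
(* With no colours there is no edge; otherwise [k] is a successor, as [inord] requires. *)
case: k => [|k] ck /properP pc.
  rewrite leqn0 cards_eq0; apply/eqP/setP=> y; rewrite !inE; apply/negP=> exy.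
  by have := ck _ (mem_edges exy).
rewrite -[k.+1]card_ord -(@card_in_imset _ _ (fun y => inord (col c x y) : 'I_k.+1)).
  exact: max_card.
move=> y z; rewrite !inE => exy exz /(congr1 val) /=.
rewrite !inordK ?ck ?mem_edges // => E; apply: contraTeq isT => yz.
by have := pc _ _ _ exy exz yz; rewrite E eqxx.
Qed.

(** The edges at [y] already need [#|N y|] colours, and those at [x] use fewer. *)
Lemma exists_free_colour c k x y :
  colouring_with e c k -> proper_colouring e c -> #|N x| < #|N y| ->
  exists2 i, i < k & forall z, e x z -> col c x z != i.
Proof.
move=> ck pc xy; have xk := leq_trans xy (leq_degree_colours y ck pc).
case: k => // k in ck xk *.
pose F := (fun y => inord (col c x y) : 'I_k.+1) @: N x.
have /subsetPn[i _ iF] : ~~ ([set: 'I_k.+1] \subset F).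
  apply: contraTN xk => /subset_leq_card; rewrite cardsT card_ord -leqNgt.
  by move=> kF; apply: leq_trans kF (leq_imset_card _ _).
exists i => // z exz; apply: contraNneq iF => E; apply/imsetP; exists z; rewrite ?inE //.
by rewrite E inord_val.
Qed.

(** An edge has two orientations, distinct by irreflexivity. This turns the edge hypothesis into a
    bound on ordered pairs. *)
Lemma double_edges_leq : #|edges e| * 2 <= #|[set xy : T * T | e xy.1 xy.2]|.
Proof.
pose f (xy : T * T) := [set xy.1; xy.2].
rewrite -[leqRHS]sum1_card (partition_big f (mem (edges e))) /=; last first.
  by move=> [x y]; rewrite inE; apply: mem_edges.
rewrite -sum_nat_const; apply: leq_sum => A /edgeP[x [y [exy ->]]].
rewrite sum1_card; have /subset_leq_card : [set (x, y); (y, x)] \subset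
   [pred i | (i \in [set xy : T * T | e xy.1 xy.2]) && (f i == [set x; y])].
  apply/subsetP => i; rewrite !inE => /orP[]/eqP-> /=; rewrite /f ?exy ?eqxx //.
  by rewrite e_sym exy setUC eqxx.
by rewrite cards2 xpair_eqE negb_and adj_neq.
Qed.

(** * Rainbow paths of length at most four, and the pairs that lack them *)

Lemma proper_consecutive c x y z :
  proper_colouring e c -> e x y -> e y z -> x != z -> col c x y != col c y z.
Proof. by move=> /properP pc exy eyz xz; rewrite setUC pc // e_sym. Qed.

(** Only what properness does not give is tested: no colours for lengths one and two, the first edge
    against the last for length three. The vertices of a path of length three are then distinct as
    soon as [u] and [v] are distinct and not adjacent. *)
Definition short_rainbow (c : {set T} -> nat) u v :=
  [|| e u v,
      [exists x, e u x && e x v],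
      [exists x, exists y, [&& e u x, e x y, e y v & col c u x != col c y v]] |
      [exists x, exists y, exists z,
        [&& e u x, e x y, e y z, e z v, uniq [:: u; x; y; z; v] &
            uniq [:: col c u x; col c x y; col c y z; col c z v]]]].

Lemma short_rainbow_path c u v :
  proper_colouring e c -> u != v -> short_rainbow c u v -> rainbow_path e c u v.
Proof.
move=> pc uv; rewrite /short_rainbow.
have [euv _|euv] := boolP (e u v).
  by exists [:: v]; rewrite /= inE euv eqxx uv.
case/or4P=> [//|/existsP[x /andP[eux exv]]|/existsP[x /existsP[y /and4P[eux exy eyv cuv]]]|].
- exists [:: x; v]; rewrite /= !inE !negb_or eux exv eqxx uv !adj_neq //=.
  by rewrite (proper_consecutive pc).
- have xv : x != v by apply: contraNneq euv => <-.
  have uy : u != y by apply: contraNneq euv => ->.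
  exists [:: x; y; v]; rewrite /= !inE !negb_or eux exy eyv eqxx uv xv uy !adj_neq //=.
  by rewrite cuv !(proper_consecutive pc).
case/existsP=> x /existsP[y /existsP[z /and5P[eux exy eyz ezv /andP[U1 U2]]]].
by exists [:: x; y; z; v]; rewrite /= eux exy eyz ezv eqxx /=; apply/andP; split.
Qed.

(** Path reversal; it allows the ends of a bad pair to be ordered by degree. *)
Lemma short_rainbow_sym c u v : short_rainbow c u v = short_rainbow c v u.
Proof.
suff imp a b : short_rainbow c a b -> short_rainbow c b a by apply/idP/idP; exact: imp.
rewrite /short_rainbow.
case/or4P => [eab|/existsP[x /andP[eax exb]]|
              /existsP[x /existsP[y /and4P[eax exy eyb cab]]]|
              /existsP[x /existsP[y /existsP[z /and5P[eax exy eyz ezb /andP[U1 U2]]]]]];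
  apply/or4P.
- by rewrite e_sym eab; constructor.
- by constructor 2; apply/existsP; exists x; rewrite e_sym exb e_sym eax.
- constructor 3; apply/existsP; exists y; apply/existsP; exists x.
  by rewrite e_sym eyb e_sym exy e_sym eax setUC eq_sym setUC.
constructor 4.
apply/existsP; exists z; apply/existsP; exists y; apply/existsP; exists x.
rewrite e_sym ezb e_sym eyz e_sym exy e_sym eax /=.
rewrite (setUC [set b]) (setUC [set z] [set y]) (setUC [set y] [set x]) (setUC [set x] [set a]).
by apply/andP; split; [move: U1 | move: U2]; rewrite -rev_uniq.
Qed.

Lemma not_short_rainbow c u v : ~~ short_rainbow c u v ->
  [/\ ~~ e u v, forall x, e u x -> ~~ e x v,
      forall x y, e u x -> e x y -> e y v -> col c u x = col c y v &
      forall x y z, e u x -> e x y -> e y z -> e z v -> uniq [:: u; x; y; z; v] ->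
        ~~ uniq [:: col c u x; col c x y; col c y z; col c z v]].
Proof.
rewrite /short_rainbow 3!negb_or => /and4P[euv /existsPn n1 /existsPn n2 /existsPn n3].
split=> // [x eux|x y eux exy eyv|x y z eux exy eyz ezv U].
- by have := n1 x; rewrite eux.
- have /existsPn/(_ y) := n2 x.
  by rewrite eux exy eyv /= negbK => /eqP.
by have /existsPn/(_ y)/existsPn/(_ z) := n3 x; rewrite eux exy eyz ezv U.
Qed.

(* All counts are of ordered pairs, so each edge and each missing pair is counted twice. *)
Lemma bad_pair_structure c u v :
  proper_colouring e c -> connected_graph e -> 'C(#|T| - 2, 2) + 2 <= #|edges e| ->
  u != v -> ~~ short_rainbow c u v -> #|N u| <= #|N v| ->
  let S := [set xy in setX (N u) (N v) | e xy.1 xy.2] in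
  [/\ #|N u| = 1 \/ #|N u| = 2 /\ #|N v| = 2,
      #|S| = #|N u|,
      {in S &, injective fst} /\ {in S &, injective snd} &
      forall x y, x != y -> x \notin [set u; v] -> y \notin [set u; v] -> ~~ e x y ->
        e u x /\ e v y \/ e u y /\ e v x].
Proof.
move=> pc con sz uv bad ab S; have [euv nox same _] := not_short_rainbow bad.
(* Two edges from one [x] into [N v] would give two edges at [v] the colour of [ux]. The same
   argument at [u] gives [S2], so [S] is a matching. *)
have S1 : {in S &, injective fst}.
  move=> [x y] [x' y']; rewrite !inE /= => /andP[/andP[ux vy] xy] /andP[/andP[ux' vy'] xy'] E.
  rewrite -{x' ux'}E in xy' *; congr pair; apply: contraTeq isT => yy.
  have /properP := pc => /(_ v y y' vy vy' yy).
  have Cy := same x y ux xy; have Cy' := same x y' ux xy'; rewrite ![e _ v]e_sym in Cy Cy'.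
  by rewrite [[set v; y]]setUC [[set v; y']]setUC -Cy // -Cy' // eqxx.
have S2 : {in S &, injective snd}.
  move=> [x y] [x' y']; rewrite !inE /= => /andP[/andP[ux vy] xy] /andP[/andP[ux' vy'] xy'] E.
  rewrite -{y' vy'}E in xy' *; congr pair; apply: contraTeq isT => xx.
  have /properP := pc => /(_ u x x' ux ux' xx).
  by rewrite (same x y) ?(same x' y) ?eqxx // e_sym.
have Sa : #|S| <= #|N u|.
  rewrite -(card_in_imset S1); apply/subset_leq_card/subsetP=> x /imsetP[[? ?]].
  by rewrite !inE /= => /andP[/andP[? _] _] ->.
have nbr x y : x != y -> 0 < #|N x|.
  move=> xy; have /connectP[[|z p] /=] := con x y; first by move=> _ /esym E; rewrite E eqxx in xy.
  by case/andP=> xz _ _; apply/card_gt0P; exists z; rewrite inE.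
have a0 := nbr u v uv; have b0 : 0 < #|N v| by rewrite (nbr v u) // eq_sym.
pose W := ~: [set u; v].
have cW : #|W| = #|T| - 2 by rewrite cardsCs setCK cards2 uv.
pose Off := [set xy in setX W W | xy.1 != xy.2].
have cOff : #|Off| = (#|T| - 2) * (#|T| - 2).-1.
  have -> : Off = setX W W :\: [set (x, x) | x in W].
    apply/setP=> [[x y]]; rewrite inE in_setX in_setD in_setX /= andbC.
    case: (altP (x =P y)) => [->|xy] /=.
      by case yW: (y \in W); rewrite ?andbF //= imset_f.
    suff -> : ((x, y) \in [set (x, x) | x in W]) = false by [].
    by apply/imsetP=> -[z _ [xz yz]]; rewrite xz yz eqxx in xy.
  rewrite cardsD (setIidPr _).
    rewrite card_imset ?cardsX ?cW => [|x y []//]; nia.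
  by apply/subsetP=> _ /imsetP[x xW ->]; rewrite in_setX xW.
pose P := [set xy : T * T | e xy.1 xy.2].
pose M := Off :\: P.
(* An adjacent pair either lies in [Off] or has an end in {u, v}; [M] is the rest of [Off]. *)
have cP : #|P| + #|M| <= #|Off| + 2 * #|N u| + 2 * #|N v|.
  have PS : P \subset (Off :&: P) :|: (setX [set u] (N u) :|: setX (N u) [set u])
                     :|: (setX [set v] (N v) :|: setX (N v) [set v]).
    apply/subsetP=> [[x y]]; rewrite !inE /= => exy.
    have [xu|xu] := eqVneq x u; first by rewrite -xu exy !orbT.
    have [xv|xv] := eqVneq x v; first by rewrite -xv exy !orbT.
    have [yu|yu] := eqVneq y u; first by rewrite -yu [e y x]e_sym exy !orbT.
    have [yv|yv] := eqVneq y v; first by rewrite -yv [e y x]e_sym exy !orbT.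
    by rewrite (adj_neq exy) exy.
  have := subset_leq_card PS; have := cardsID P Off; rewrite -/M => <- le.
  have U (X Y : {set T * T}) k l : #|X| <= k -> #|Y| <= l -> #|X :|: Y| <= k + l.
    by move=> Xk Yl; rewrite (leq_trans (leq_card_setU X Y)) ?leq_add.
  have U' w : #|setX [set w] (N w) :|: setX (N w) [set w]| <= 2 * #|N w|.
    by rewrite mul2n -addnn U // cardsX cards1 ?mul1n ?muln1.
  have := leq_trans le (U _ _ _ _ (U _ _ _ _ (leqnn _) (U' u)) (U' v)).
  by move: #|P| #|M| #|Off :&: P| #|N u| #|N v| => *; lia.
(* The edge bound is doubled: twice the binomial coefficient is [#|Off|], and the two additional
   edges become the 4. *)
have M2 : #|M| + 4 <= 2 * #|N u| + 2 * #|N v|.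
  have := double_edges_leq; rewrite -/P.
  have := mul_bin_diag (#|T| - 2) 1; rewrite bin1 -cOff.
  by move: sz cP; move: #|P| #|M| #|Off| #|N u| #|N v| #|edges e| 'C(_, _) => *; lia.
(* [D] and its reverse [D'] are the missing pairs between the two neighbourhoods; they are disjoint
   because [u] and [v] have no common neighbour. *)
pose D := setX (N u) (N v) :\: P.
pose D' := setX (N v) (N u) :\: P.
have cD : #|D| = #|N u| * #|N v| - #|S|.
  by rewrite cardsD cardsX; congr (_ - #|pred_of_set _|); apply/setP=> xy; rewrite !inE.
have cD' : #|D'| = #|D|.
  rewrite -(card_imset _ (can_inj (@swap_pairK T T))); congr #|pred_of_set _|.
  apply/setP=> [[x y]]; rewrite -[(x, y)]/(swap_pair (y, x)) (mem_imset _ _ (can_inj swap_pairK)).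
  by rewrite !inE /= e_sym andbA [X in X && _]andbC -andbA andbC -!andbA; congr (_ && _); rewrite andbC.
have DM : D :|: D' \subset M.
  apply/subsetP=> [[x y]]; rewrite !inE /= => xyD.
  have {xyD} : ~~ e x y /\ (e u x /\ e v y \/ e u y /\ e v x).
    by case/orP: xyD => /and3P[-> ? ?]; split=> //; [left | right].
  have far w z : e u w -> e v z -> w != z /\ [&& w != u, w != v, z != u & z != v].
    move=> uw vz; have wv : w != v by apply: contraNneq euv => <-.
    have zu : z != u by apply: contraNneq euv => <-; rewrite e_sym.
    rewrite [w == u]eq_sym [z == v]eq_sym (adj_neq uw) (adj_neq vz) wv zu; split=> //.
    by apply: contraTneq vz => <-; rewrite e_sym nox.
  case=> nxy [] [h1 h2]; rewrite nxy !negb_or.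
    by have [-> /and4P[-> -> -> ->]] := far x y h1 h2.
  by have [] := far y x h1 h2; rewrite eq_sym => -> /and4P[-> -> -> ->].
have cDD : #|D :|: D'| = 2 * #|D|.
  rewrite cardsU cD' (_ : D :&: D' = set0) ?cards0; first lia.
  apply/setP=> [[x y]]; rewrite !inE /=; apply/negP=> /andP[/and3P[_ ux _] /and3P[_ vx _]].
  by have := nox x ux; rewrite e_sym vx.
have := subset_leq_card DM; rewrite cDD cD => lM.
(* Together [lM] and [M2] give 2(ab - |S|) + 4 <= 2a + 2b. With [Sa] this leaves a = 1 or a = b = 2,
   and in both cases it then forces |S| >= a. *)
have [a12 Sa'] : (#|N u| = 1 \/ #|N u| = 2 /\ #|N v| = 2) /\ #|S| = #|N u|.
  have [a1|a2] : #|N u| = 1 \/ 2 <= #|N u| by lia.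
    by split; [left | lia].
  have b2 : #|N v| = 2 by nia.
  by have a2' : #|N u| = 2 by [lia]; rewrite a2' b2 in lM M2 *; split; [right | lia].
split=> // x y xy xW yW nexy.
have : (x, y) \in D :|: D'.
  (* For these values the upper bound on [M] equals the size of [D :|: D'], so no other pair off {u,
     v} is missing. *)
  have /eqP-> : D :|: D' == M by rewrite eqEcard DM cDD cD; nia.
  by rewrite in_setD [_ \in P]inE [_ \in Off]inE in_setX !in_setC /= nexy xy xW yW.
by rewrite !inE => /orP[]/andP[_ /andP[]]; [left|right].
Qed.

(** * Identification with a listed graph, and colourings that connect every pair *)

(** The isomorphism is the position in [s]. Symmetry reduces the check to i < j, and on the diagonal
    irreflexivity matches the absence of loops in [l]. *)
Lemma graph_iso_rel_of_list n l (s : seq T) x0 :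
  uniq s -> size s = n -> #|T| = n -> all (fun ij => ij.1 != ij.2) l ->
  (forall i j, i < j < n -> e (nth x0 s i) (nth x0 s j) = ((i, j) \in l) || ((j, i) \in l)) ->
  graph_iso e (rel_of_list n l).
Proof.
move=> us ss Tn ll adj.
have sT x : x \in s.
  have /subset_cardP sE : #|s| = #|T| by rewrite (card_uniqP us) ss.
  by rewrite (sE (subset_predT _)).
have lt x : index x s < n by rewrite -ss index_mem.
exists (fun x => Ordinal (lt x)); split=> [|x y].
  apply: inj_card_bij; last by rewrite card_ord Tn.
  by move=> x y [E]; rewrite -(nth_index x0 (sT x)) E nth_index.
rewrite /rel_of_list /= -{3}(nth_index x0 (sT x)) -{3}(nth_index x0 (sT y)).
case: (ltngtP (index x s) (index y s)) => [xy|yx|<-].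
- by rewrite adj // xy lt.
- by rewrite orbC e_sym adj // yx lt.
by rewrite e_irr orbb; apply/negP => /(allP ll) /=; rewrite eqxx.
Qed.

Lemma exists_notin (s : seq T) : size s < #|T| -> exists x, x \notin s.
Proof.
move=> sT; have /subsetPn[x _ xs] : ~~ (T \subset s).
  by apply: contraTN sT => /subset_leq_card Ts; rewrite -leqNgt (leq_trans Ts) ?card_size.
by exists x.
Qed.

Lemma short_rainbow1 c x y : e x y -> short_rainbow c x y.
Proof. by rewrite /short_rainbow => ->. Qed.

Lemma short_rainbow2 c x y z : e x z -> e z y -> short_rainbow c x y.
Proof.
by move=> xz zy; apply/or4P; constructor 2; apply/existsP; exists z; rewrite xz.
Qed.

Lemma short_rainbow3 c x y a b :
  e x a -> e a b -> e b y -> col c x a != col c b y -> short_rainbow c x y.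
Proof.
move=> xa ab by_ cc; apply/or4P; constructor 3; apply/existsP; exists a; apply/existsP; exists b.
by rewrite xa ab by_.
Qed.

(* The clique T \ {u, v} of order m = #|T| - 2 >= 3 is coloured by adding the labels of
   the ends modulo m. Giving [u] the label 0 of [p] and [v] the label 1 of [q]
   keeps the colouring proper and gives the two pendant edges the colours 0 and 2. *)
Lemma clique_two_pendants_colouring u v p q :
  u != v -> p != q -> p \notin [:: u; v] -> q \notin [:: u; v] -> 
  (forall x, e u x = (x == p)) -> (forall x, e v x = (x == q)) ->
  (forall x y, x != y -> x \notin [:: u; v] -> y \notin [:: u; v] -> e x y) ->
  5 <= #|T| ->
  exists c, [/\ colouring_with e c (#|T| - 2), proper_colouring e c &
                forall x y, x != y -> short_rainbow c x y].
Proof.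
move=> uv pq puv quv eu ev cl T5.
have us : uniq [:: u; v; p; q].
  move: puv quv; rewrite /= !inE !negb_or => /andP[pu pv] /andP[qu qv].
  by rewrite pq uv [u == p]eq_sym [u == q]eq_sym [v == p]eq_sym [v == q]eq_sym pu pv qu qv.
(* [p] and [q] come first so that their labels are 0 and 1. *)
pose s := [:: p, q & enum [predC [:: u; v; p; q]]].
pose m := #|T| - 2.
have sm : size s = m.
  rewrite /= -cardE /m -(cardC (mem [:: u; v; p; q])) (card_uniqP us) /=.
  by rewrite !addSn !subSS subn0.
pose rep x := if x == u then p else if x == v then q else x.
have rep_s x : rep x \in s.
  rewrite /rep; have [|xu] := eqVneq x u; first by rewrite inE eqxx.
  have [|xv] := eqVneq x v; first by rewrite !inE eqxx orbT.
  rewrite !inE mem_enum !inE (negPf xu) (negPf xv) /=.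
  by case: (x == p); case: (x == q).
pose lab x := index (rep x) s.
have lab_m x : lab x < m by rewrite -sm index_mem.
have lab_p : lab p = 0.
  by move: puv; rewrite /lab /rep !inE negb_or => /andP[/negPf-> /negPf->]; rewrite /= eqxx.
have lab_q : lab q = 1.
  move: quv; rewrite /lab /rep !inE negb_or => /andP[/negPf-> /negPf->].
  by rewrite /= (negPf pq) eqxx.
have lab_u : lab u = 0 by rewrite /lab /rep eqxx /= eqxx.
have lab_v : lab v = 1 by rewrite /lab /rep eq_sym (negPf uv) eqxx /= (negPf pq) eqxx.
(* Summing over the set makes the colour independent of the order of the ends. *)
pose c (E : {set T}) := (\sum_(x in E) lab x) %% m.
have cE x y : e x y -> col c x y = (lab x + lab y) %% m.
  by move=> exy; rewrite /c big_setU1 ?inE ?adj_neq //= big_set1.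
have up : e u p by rewrite eu.
have vq : e v q by rewrite ev.
have pq' : e p q by apply: cl.
have pc : proper_colouring e c.
  apply/properP => x y z exy exz yz; rewrite !cE // eqn_modDl !modn_small //.
  apply: contraNneq yz => lyz.
  have : rep y = rep z by rewrite -(nth_index p (rep_s y)) -/(lab y) lyz nth_index.
  (* Distinct vertices share a label only as {u, p} or {v, q}. The only neighbour of [u] is [p],
     which is not adjacent to itself, so no [x] sees both; likewise for [v] and [q]. *)
  have no w w' : e x w -> e x w' -> w = u -> w' = p -> False.
    by move=> xw xw' E E'; move: xw; rewrite E e_sym eu => /eqP xp; move: xw'; rewrite xp E' e_irr.
  have no' w w' : e x w -> e x w' -> w = v -> w' = q -> False.
    by move=> xw xw' E E'; move: xw; rewrite E e_sym ev => /eqP xp; move: xw'; rewrite xp E' e_irr.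
  rewrite /rep; case: (eqVneq y u) => yu; case: (eqVneq z u) => zu; try by rewrite yu zu.
  - case: (eqVneq z v) => zv E; first by rewrite E eqxx in pq.
    by case: (no y z).
  - case: (eqVneq y v) => yv E; first by rewrite E eqxx in pq.
    by case: (no z y).
  case: (eqVneq y v) => yv; case: (eqVneq z v) => zv; try by rewrite ?yv ?zv // => ->.
  - by move=> E; case: (no' y z).
  by move=> E; case: (no' z y).
exists c; split=> //; first by move=> A /edgeP[x [y [exy ->]]]; rewrite cE // ltn_mod; lia.
have su y : y != u -> short_rainbow c u y.
  move=> yu; have [->|yp] := eqVneq y p; first exact: short_rainbow1.
  have [->|yv] := eqVneq y v.
    apply: (@short_rainbow3 _ _ _ p q) => //; first by rewrite e_sym.
    rewrite !cE // 1?e_sym // lab_u lab_p lab_q lab_v mod0n modn_small //; lia.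
  apply: (@short_rainbow2 _ _ _ p) => //; apply: cl => //; first by rewrite eq_sym.
  by rewrite !inE negb_or yu.
have sv y : y != v -> short_rainbow c v y.
  move=> yv; have [->|yq] := eqVneq y q; first exact: short_rainbow1.
  have [->|yu] := eqVneq y u; first by rewrite short_rainbow_sym su // eq_sym.
  apply: (@short_rainbow2 _ _ _ q) => //; apply: cl => //; first by rewrite eq_sym.
  by rewrite !inE negb_or yu.
move=> x y xy.
have [xu|xu] := eqVneq x u; first by rewrite xu su // -xu eq_sym.
have [xv|xv] := eqVneq x v; first by rewrite xv sv // -xv eq_sym.
have [yu|yu] := eqVneq y u; first by rewrite yu short_rainbow_sym su.
have [yv|yv] := eqVneq y v; first by rewrite yv short_rainbow_sym sv.
by apply/short_rainbow1/cl; rewrite // !inE negb_or ?xu ?yu.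
Qed.

(** The edge [up] meets other edges only at [p], because [u] has degree one; hence freeness at [p]
    suffices. *)
Lemma recolour_pendant c k u p i :
  colouring_with e c k -> proper_colouring e c -> (forall x, e u x = (x == p)) ->
  i < k -> (forall z, e p z -> col c p z != i) ->
  let c' := fun E => if E == [set u; p] then i else c E in
  colouring_with e c' k /\ proper_colouring e c'.
Proof.
move=> ck pc eu ik free c'; split=> [A Ae|]; first by rewrite /c'; case: ifP => // _; apply: ck.
have end_up x y : e x y -> [set x; y] = [set u; p] -> x = p /\ y = u \/ x = u.
  move=> xy E; have : x \in [set u; p] by rewrite -E !inE eqxx.
  rewrite !inE => /orP[/eqP|/eqP xp]; [by right | left].
  by rewrite xp [RHS]setUC in E; have := set2_injr E.
have not_u x y z : e x y -> e x z -> y != z -> x != u.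
  by move=> xy xz; apply: contraNneq => xu; move: xy xz; rewrite xu !eu => /eqP-> /eqP->.
apply/properP=> x y z xy xz yz; have xu := not_u _ _ _ xy xz yz; rewrite /c'.
have at_p w : e x w -> [set x; w] = [set u; p] -> x = p /\ w = u.
  by move=> xw /(end_up x w xw) [//|xu']; rewrite xu' eqxx in xu.
have [/(at_p y xy) [xp yu]|Ny] := eqVneq [set x; y] [set u; p];
  have [/(at_p z xz) [xp' zu]|Nz] := eqVneq [set x; z] [set u; p].
- by rewrite yu zu eqxx in yz.
- by rewrite xp in xz *; rewrite eq_sym free.
- by rewrite xp' in xy *; apply: free.
by move/properP: pc; apply.
Qed.

(* A colour is free at [p] because the degree of [q] is larger. *)
Lemma clique_pendant_cherry_colouring c k u v p q r :
  colouring_with e c k -> proper_colouring e c -> col c u p = col c q v ->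
  uniq [:: u; v; p; q; r] -> 6 <= #|T| ->
  (forall x, e u x = (x == p)) -> (forall x, e v x = (x == q) || (x == r)) ->
  (forall x, x \notin [:: u; v; p; r] -> e p x) -> ~~ e p r ->
  (forall x y, x != y -> x \notin [:: u; v; p] -> y \notin [:: u; v; p] -> e x y) ->
  exists c, [/\ colouring_with e c k, proper_colouring e c &
                forall x y, x != y -> short_rainbow c x y].
Proof.
move=> ck pc bad us T6 eu ev ep epr cl.
have up : e u p by rewrite eu.
have vq : e v q by rewrite ev eqxx.
have vr : e v r by rewrite ev eqxx orbT.
have [uv up' uq ur] : [/\ u != v, u != p, u != q & u != r].
  by move: us; rewrite /= !inE !negb_or; case/and3P=> /and4P[].
have [vp vq' vr'] : [/\ v != p, v != q & v != r].
  by move: us; rewrite /= !inE !negb_or; case/and3P=> _ /and3P[].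
have [pq pr qr] : [/\ p != q, p != r & q != r].
  by move: us; rewrite /= !inE !negb_or; case/and4P=> _ _ /andP[-> ->] /andP[-> _].
have [qu qv qp] : [/\ q != u, q != v & q != p] by split; rewrite eq_sym.
have [ru rv rp] : [/\ r != u, r != v & r != p] by split; rewrite eq_sym.
have epq : e p q by rewrite ep // !inE !negb_or qu qv qp.
(* With n = [#|T|]: [p] misses at least [p], [v], [r], so its degree is at most n - 3; [q] misses
   only [u] and itself, so its degree is at least n - 2. *)
have deg : #|N p| < #|N q|.
  have : #|N p| + 3 <= #|T|.
    have us3 : uniq [:: p; v; r] by rewrite /= !inE negb_or pr vr' eq_sym vp.
    rewrite -(cardC (N p)) leq_add2l -[leqLHS]/(size [:: p; v; r]) -(card_uniqP us3) subset_leq_card //.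
    apply/subsetP=> x; rewrite !inE => /or3P[]/eqP->; rewrite ?e_irr //.
    by rewrite e_sym ev negb_or pq pr.
  have : #|T| <= #|N q| + 2.
    rewrite -(cardC (N q)) leq_add2l (leq_trans _ (card_size [:: u; q])) //.
    apply: subset_leq_card; apply/subsetP=> x; rewrite !inE; apply: contraR; rewrite negb_or.
    case/andP=> xu xq; have [->|xv] := eqVneq x v; first by rewrite e_sym.
    have [->|xp] := eqVneq x p; first by rewrite e_sym.
    by rewrite cl 1?eq_sym // !inE !negb_or ?qu ?qv ?qp ?xu ?xv ?xp.
  by move=> Tq pT; have := leq_trans pT Tq; rewrite -[3]/(1 + 2) addnA leq_add2r addn1.
have [i ik free] := exists_free_colour ck pc deg.
have [] := recolour_pendant ck pc eu ik free; set c' := fun E => _ => ck' pc'.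
exists c'; split=> //.
have c'up : col c' u p = i by rewrite /c' eqxx.
have c'E x y : x != u -> y != u -> col c' x y = col c x y.
  move=> xu yu; rewrite /c' ifN //; apply/eqP=> E; have : u \in [set x; y] by rewrite E !inE eqxx.
  by rewrite !inE [u == x]eq_sym [u == y]eq_sym (negPf xu) (negPf yu).
(* A sixth vertex provides a second route from [u] to [r]. *)
have [w] : exists w, w \notin [:: u; v; p; q; r] by apply: exists_notin.
rewrite !inE !negb_or => /and5P[wu wv wp wq wr].
have epw : e p w by rewrite ep // !inE !negb_or wu wv wp wr.
have ewr : e w r by rewrite cl // !inE !negb_or ?wu ?wv ?wp ?ru ?rv ?rp.
have eqr : e q r.
  by rewrite cl // !inE !negb_or ?qu ?qv ?qp ?ru ?rv ?rp.
have su y : y != u -> short_rainbow c' u y.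
  move=> yu; have [->|yp] := eqVneq y p; first exact: short_rainbow1.
  have [->|yv] := eqVneq y v.
    (* The edge [qv] carries the old colour of [up], which occurs at [p] and so differs from the
       free colour [i]. *)
    apply: (@short_rainbow3 _ _ _ p q) => //; first by rewrite e_sym.
    by rewrite c'up c'E 1?[v == u]eq_sym // -bad eq_sym setUC free // e_sym.
  have [->|yr] := eqVneq y r.
    (* If [qr] has colour [i], then [wr] does not, since the two edges meet at [r]. *)
    have [qri|qri] := eqVneq (col c q r) i; last first.
      by apply: (@short_rainbow3 _ _ _ p q) => //; rewrite c'up c'E // eq_sym.
    apply: (@short_rainbow3 _ _ _ p w) => //; rewrite c'up c'E // -qri.
    by rewrite [[set w; r]]setUC (proper_consecutive pc) // 1?e_sym // eq_sym.
  by apply: (@short_rainbow2 _ _ _ p); rewrite // ep // !inE !negb_or yu yv yp yr.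
(* Apart from [u], every vertex is joined to [q], so the remaining pairs are at distance at most
   two. *)
have nq z : z != q -> z != u -> e z q.
  move=> zq zu; have [->//|zv] := eqVneq z v; have [->//|zp] := eqVneq z p.
  by rewrite cl // !inE !negb_or ?zu ?zv ?zp // qu qv qp.
move=> x y xy.
have [xu|xu] := eqVneq x u; first by rewrite xu su // -xu eq_sym.
have [yu|yu] := eqVneq y u; first by rewrite yu short_rainbow_sym su.
have [xq|xq] := eqVneq x q; first by apply: short_rainbow1; rewrite xq e_sym nq // -xq eq_sym.
have [yq|yq] := eqVneq y q; first by apply: short_rainbow1; rewrite yq nq // -yq.
by apply: (@short_rainbow2 _ _ _ q); rewrite 1?[e q _]e_sym nq.
Qed.

(** * Bad pairs, by the number of neighbours of their ends *)

(** Off {u, v, p} the graph is complete, and there [p] misses exactly the neighbours of [v] other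
    than [q]. Only their number remains free; the cases 0, 1 and at least 2 are treated in turn. *)
Lemma bad_pair_one_neighbour c k u v :
  colouring_with e c k -> proper_colouring e c -> connected_graph e ->
  'C(#|T| - 2, 2) + 2 <= #|edges e| ->
  u != v -> ~~ short_rainbow c u v -> #|N u| <= #|N v| -> #|N u| = 1 ->
  (exists c', [/\ colouring_with e c' k, proper_colouring e c' &
                forall x y, x != y -> short_rainbow c' x y])
  \/ graph_iso e P4 \/ graph_iso e Z2.
Proof.
move=> ck pc con sz uv bad ab a1.
have [_ cS _ st] := bad_pair_structure pc con sz uv bad ab.
have [euv nox same long] := not_short_rainbow bad.
move/eqP/cards1P: (a1) => [p Np].
have eu x : e u x = (x == p) by have := in_set1 x p; rewrite -Np inE.
move: cS; rewrite a1 => /eqP/cards1P[[p' q] ES].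
have : (p', q) \in [set (p', q)] by rewrite set11.
rewrite -ES !inE /= eu => /andP[/andP[/eqP Ep evq] epq]; rewrite {p'}Ep in ES epq.
have q_only y : e v y -> e p y -> y = q.
  move=> vy py; have : (p, y) \in [set (p, q)] by rewrite -ES !inE /= eu eqxx vy py.
  by rewrite inE => /eqP[].
have eup : e u p by rewrite eu.
have vu : v != u by rewrite eq_sym.
have pq := adj_neq epq; have qp : q != p by rewrite eq_sym.
have pu : p != u by rewrite eq_sym adj_neq.
have qv : q != v by rewrite eq_sym adj_neq.
have vp : v != p by rewrite -eu.
have pv : p != v by rewrite eq_sym.
have qu : q != u by apply: contraNneq euv => <-; rewrite e_sym.
have evp : ~~ e v p by rewrite e_sym nox.
have cl x y : x != y -> x \notin [:: u; v; p] -> y \notin [:: u; v; p] -> e x y.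
  rewrite !inE !negb_or => xy /and3P[xu xv xp] /and3P[yu yv yp]; apply: contraT => nxy.
  have := st x y xy; rewrite !inE !negb_or xu xv yu yv !eu (negPf xp) (negPf yp).
  by move/(_ isT isT nxy) => -[[]|[]].
have ep y : y \notin [:: u; v; p] -> ~~ e v y -> e p y.
  rewrite !inE !negb_or => /and3P[yu yv yp] vy; apply: contraT => npy.
  have := st p y _ _ _ npy; rewrite eq_sym !inE !negb_or pu pv yu yv !eu (negPf vy) (negPf yp).
  by move/(_ isT isT isT) => -[[]|[]].
have cD : #|N v| = (#|N v :\ q|).+1 by rewrite (cardsD1 q) inE evq.
have us4 : uniq [:: u; v; p; q] by rewrite /= !inE !negb_or uv ![_ == p]eq_sym ![_ == q]eq_sym pu qu pv qv qp.
have T4 : 4 <= #|T| by rewrite -[4]/(size [:: u; v; p; q]) -(card_uniqP us4) max_card.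
have : [\/ #|N v :\ q| = 0, #|N v :\ q| = 1 | 1 < #|N v :\ q|].
  by case: #|N v :\ q| => [|[|?]]; [constructor 1 | constructor 2 | constructor 3].
case=> [/eqP|/eqP/cards1P[r Er]|/card_gt1P[y [z [yD zD yz]]]].
- rewrite cards_eq0 => /eqP E0.
  have ev x : e v x = (x == q).
    have := in_set0 x; rewrite -E0 !inE; case: eqP => [->|] //=.
  have cl2 x y : x != y -> x \notin [:: u; v] -> y \notin [:: u; v] -> e x y.
    have ep' w : w != p -> w \notin [:: u; v] -> e p w.
      move=> wp wuv; have [->//|wq] := eqVneq w q; apply: ep; last by rewrite ev.
      by move: wuv; rewrite !inE !negb_or => /andP[-> ->].
    move=> xy xuv yuv; have [xp|xp] := eqVneq x p; first by rewrite xp ep' // -xp eq_sym.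
    have [yp|yp] := eqVneq y p; first by rewrite yp e_sym ep'.
    by apply: cl => //; rewrite !inE ?negb_or in xuv yuv *;
       [rewrite xp andbT | rewrite yp andbT].
  have [T5|T4'] : 5 <= #|T| \/ #|T| = 4.
    by move: T4; rewrite leq_eqVlt => /orP[/eqP<-|]; [right|left].
    left; have [||c' [ck' pc' sr]] := clique_two_pendants_colouring uv pq _ _ eu ev cl2 T5.
    + by rewrite !inE negb_or pu.
    + by rewrite !inE negb_or qu.
    exists c'; split=> // A Ae; apply: leq_trans (ck' A Ae) _.
    (* The new colouring has n - 2 colours with n = [#|T|], and [k] is at least the degree of [p],
       which misses only itself and [v]. *)
    apply: leq_trans (leq_degree_colours p ck pc).
    rewrite leq_subLR addnC -(cardC (N p)) leq_add2l.
    apply: (leq_trans _ (card_size [:: p; v])).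
    apply: subset_leq_card; apply/subsetP=> x; rewrite !inE; apply: contraR; rewrite negb_or.
    case/andP=> xp xv; have [->|xu] := eqVneq x u; first by rewrite e_sym.
    by rewrite cl2 1?eq_sym // !inE negb_or ?pu ?xu.
  right; left; apply: (@graph_iso_rel_of_list _ _ [:: u; p; q; v] u) => //.
    by rewrite /= !inE !negb_or uv pq pv qv [u == p]eq_sym [u == q]eq_sym pu qu.
  have E1 : e u q = false by rewrite eu (negPf qp).
  have E2 : e p v = false by rewrite e_sym ev (negPf pq).
  have E3 : e q v by rewrite e_sym.
  by case=> [|[|[|i]]] [|[|[|[|j]]]] //=; rewrite ?(negPf euv) ?ltnS ?ltn0 ?andbF.
- have [rq evr] : r != q /\ e v r.
    by have := set11 r; rewrite -Er !inE => /andP[].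
  have ev x : e v x = (x == q) || (x == r).
    by have := in_set1 x r; rewrite -Er !inE; case: eqP => [->|] //=.
  have npr : ~~ e p r by apply: contraNN rq => pr; rewrite (q_only r).
  have rv : r != v by rewrite eq_sym adj_neq.
  have rp : r != p by apply: contraNneq evp => <-.
  have ru : r != u by apply: contraNneq euv => <-; rewrite e_sym.
  have us5 : uniq [:: u; v; p; q; r].
    rewrite -(rot_uniq 4) [rot _ _]/= cons_uniq us4 andbT !inE !negb_or.
    by rewrite ru rv rp rq.
  have [T6|T5] : 6 <= #|T| \/ #|T| = 5.
    have : 5 <= #|T| by rewrite -[5]/(size [:: u; v; p; q; r]) -(card_uniqP us5) max_card.
    by rewrite leq_eqVlt => /orP[/eqP<-|]; [right|left].
    left; apply: (clique_pendant_cherry_colouring ck pc _ us5) => //; first by rewrite (same p q) // e_sym.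
    move=> x; have [->//|xq] := eqVneq x q; rewrite !inE !negb_or => /and4P[xu xv xp xr].
    by apply: ep; [rewrite !inE !negb_or xu xv xp | rewrite ev negb_or xq xr].
  (* The triangle is [q], [r], [v]; the path [p], [u] hangs at [q]. *)
  right; right; apply: (@graph_iso_rel_of_list _ _ [:: q; r; v; p; u] u) => //.
    by rewrite /= !inE !negb_or [q == r]eq_sym rq qv qp qu rv rp ru vp vu pu.
  have E1 : e q r by rewrite cl // 1?eq_sym // !inE !negb_or ?qu ?qv ?ru ?rv ?rp.
  have E2 : e q v by rewrite e_sym.
  have E3 : e q p by rewrite e_sym.
  have E4 : e q u = false by rewrite e_sym eu (negPf qp).
  have E5 : e r v by rewrite e_sym.
  have E6 : e r p = false by rewrite e_sym (negPf npr).
  have E7 : e r u = false by rewrite e_sym eu (negPf rp).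
  have E8 : e p u by rewrite e_sym.
  by case=> [|[|[|[|i]]]] [|[|[|[|[|j]]]]] //=;
    rewrite ?(negPf evp) ?[e v u]e_sym ?(negPf euv) ?ltnS ?ltn0 ?andbF.
(* In the path u-p-q-w-v every other coincidence of colours is excluded by properness, using that
   [up] and [qv] have the same colour. *)
have key w : w \in N v :\ q -> col c p q = col c w v.
  rewrite !inE => /andP[wq evw].
  have wu : w != u by apply: contraNneq euv => <-; rewrite e_sym.
  have wv : w != v by rewrite eq_sym adj_neq.
  have wp : w != p by apply: contraNneq evp => <-.
  have eqv : e q v by rewrite e_sym.
  have ewv : e w v by rewrite e_sym.
  have eqw : e q w by rewrite cl // 1?eq_sym // !inE !negb_or ?qu ?qv ?qp ?wu ?wv ?wp.
  have pw : p != w by rewrite eq_sym.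
  have h1 : col c u p != col c p q by rewrite (proper_consecutive pc) // eq_sym.
  have h2 : col c p q != col c q w by rewrite (proper_consecutive pc).
  have h3 : col c q w != col c w v by rewrite (proper_consecutive pc).
  have h4 : col c u p != col c q w.
    by rewrite (same p q) //; move/properP: pc; apply; rewrite // eq_sym.
  have h5 : col c u p != col c w v.
    by rewrite (same p q) // ![[set _; v]]setUC; move/properP: pc; apply; rewrite // eq_sym.
  apply/eqP; apply: contraT => ne; have := long p q w eup epq eqw ewv.
  rewrite /= !inE !negb_or h1 h2 h3 h4 h5 ne uv pq pv pw qv wv.
  rewrite [u == p]eq_sym [u == q]eq_sym [u == w]eq_sym [q == w]eq_sym pu qu wu wq.
  by move/(_ isT).
(* Two such neighbours of [v] would give two edges at [v] the colour of [pq]. *)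
have := key z zD; rewrite (key y yD) => E.
move: yD zD; rewrite !inE => /andP[_ vy] /andP[_ vz].
have /properP := pc => /(_ v y z vy vz yz).
by rewrite ![[set v; _]]setUC E eqxx.
Qed.

(** The matching is x1y1, x2y2, and off {u, v} only x1y2 and x2y1 are missing. On six vertices this
    is [G63]; a seventh vertex [w] yields a rainbow path u-x1-w-y2-v. *)
Lemma bad_pair_two_neighbours c u v :
  proper_colouring e c -> connected_graph e -> 'C(#|T| - 2, 2) + 2 <= #|edges e| ->
  u != v -> ~~ short_rainbow c u v -> #|N u| = 2 -> #|N v| = 2 -> graph_iso e G63.
Proof.
move=> pc con sz uv bad a2 b2; have ab : #|N u| <= #|N v| by rewrite a2 b2.
have [_ cS [S1 S2] st] := bad_pair_structure pc con sz uv bad ab.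
have [euv nox same long] := not_short_rainbow bad.
move: cS; rewrite a2 => /eqP/cards2P[[x1 y1] [[x2 y2] [s12 ES]]].
have [s1 s2] : (x1, y1) \in [set (x1, y1); (x2, y2)] /\ (x2, y2) \in [set (x1, y1); (x2, y2)].
  by rewrite !inE !eqxx orbT.
have x12 : x1 != x2.
  by apply: contraNneq s12 => E; apply/eqP; apply: S1; rewrite ?ES.
have y12 : y1 != y2.
  by apply: contraNneq s12 => E; apply/eqP; apply: S2; rewrite ?ES.
move: s1 s2; rewrite -ES !inE /= => /andP[/andP[ux1 vy1] xy1] /andP[/andP[ux2 vy2] xy2].
have Nu : N u = [set x1; x2].
  apply/eqP; rewrite eq_sym eqEcard a2 cards2 x12 andbT; apply/subsetP=> x.
  by rewrite !inE => /orP[]/eqP->.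
have Nv : N v = [set y1; y2].
  apply/eqP; rewrite eq_sym eqEcard b2 cards2 y12 andbT; apply/subsetP=> x.
  by rewrite !inE => /orP[]/eqP->.
have eu x : e u x = (x == x1) || (x == x2) by have := in_set2 x x1 x2; rewrite -Nu inE.
have ev x : e v x = (x == y1) || (x == y2) by have := in_set2 x y1 y2; rewrite -Nv inE.
have nxy x y : e u x -> e v y -> e x y -> (x, y) = (x1, y1) \/ (x, y) = (x2, y2).
  move=> ux vy xy; have : (x, y) \in [set (x1, y1); (x2, y2)] by rewrite -ES !inE /= ux vy xy.
  by rewrite in_set2 => /orP[]/eqP; [left | right].
have x1y2 : e x1 y2 = false.
  by apply/negP=> /(nxy x1 y2 ux1 vy2)[[E]|[E]]; rewrite E eqxx in y12 x12.
have x2y1 : e x2 y1 = false.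
  by apply/negP=> /(nxy x2 y1 ux2 vy1)[[E]|[E]]; rewrite E eqxx in y12 x12.
have uy w : e v w -> w != u by apply: contraTneq => ->; rewrite e_sym.
have vx w : e u w -> w != v by apply: contraTneq => ->.
have xy w z : e u w -> e v z -> w != z by move=> uw; apply: contraTneq => <-; rewrite e_sym nox.
have ex w z : e u w -> z != w -> z != u -> z != v -> ~~ e v z -> e w z.
  move=> uw zw zu zv vz; apply: contraT => nwz; have := st w z _ _ _ nwz.
  rewrite eq_sym zw !inE !negb_or zu zv (vx w uw) [w == u]eq_sym (adj_neq uw).
  move/(_ isT isT isT) => -[[_]|[_ vw]]; first by rewrite (negPf vz).
  by have := nox w uw; rewrite e_sym vw.
have ey w z : e v w -> z != w -> z != u -> z != v -> ~~ e u z -> e w z.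
  move=> vw zw zu zv uz; apply: contraT => nwz; have := st w z _ _ _ nwz.
  rewrite eq_sym zw !inE !negb_or zu zv (uy w vw) [w == v]eq_sym (adj_neq vw).
  move/(_ isT isT isT) => -[[uw]|[uz']]; last by rewrite uz' in uz.
  by have := nox w uw; rewrite e_sym vw.
have x1v := vx _ ux1; have x2v := vx _ ux2; have y1u := uy _ vy1; have y2u := uy _ vy2.
have x1u : x1 != u by rewrite eq_sym adj_neq.
have x2u : x2 != u by rewrite eq_sym adj_neq.
have y1v : y1 != v by rewrite eq_sym adj_neq.
have y2v : y2 != v by rewrite eq_sym adj_neq.
have n11 := xy _ _ ux1 vy1; have n12 := xy _ _ ux1 vy2.
have n21 := xy _ _ ux2 vy1; have n22 := xy _ _ ux2 vy2.
have ex12 : e x1 x2 by rewrite ex // 1?eq_sym // e_sym nox.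
have ey12 : e y1 y2 by rewrite ey // 1?eq_sym // eu negb_or ![y2 == _]eq_sym n12.
have us : uniq [:: x1; y1; x2; u; v; y2].
  rewrite /= !inE !negb_or n11 n12 x12 x1u x1v [y1 == x2]eq_sym n21 y1u y1v y12 x2u x2v n22 uv.
  by rewrite [u == y2]eq_sym [v == y2]eq_sym y2u y2v.
have [T7|T6] : 7 <= #|T| \/ #|T| = 6; last 1 first.
(* The order is that of w, w1, w2, w3, u1, u2 in [G63]. *)
- apply: (@graph_iso_rel_of_list _ _ [:: x1; y1; x2; u; v; y2] u) => //.
  have E1 : e x1 u by rewrite e_sym.
  have E2 : e x2 u by rewrite e_sym.
  have E3 : e y1 v by rewrite e_sym.
  have E4 : e y1 x2 = false by rewrite e_sym.
  have E5 : e y1 u = false by apply/negP; rewrite e_sym => /nox; rewrite e_sym vy1.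
  have E6 : e u y2 = false by apply/negP=> /nox; rewrite e_sym vy2.
  have E7 : e x1 v = false by apply/negbTE/nox.
  have E8 : e x2 v = false by apply/negbTE/nox.
  by case=> [|[|[|[|[|i]]]]] [|[|[|[|[|[|j]]]]]] //=;
    rewrite ?(negPf euv) ?ltnS ?ltn0 ?andbF.
- have : 6 <= #|T| by rewrite -[6]/(size [:: x1; y1; x2; u; v; y2]) -(card_uniqP us) max_card.
  by rewrite leq_eqVlt => /orP[/eqP<-|]; [right|left].
have [w] : exists w, w \notin [:: x1; y1; x2; u; v; y2] by apply: exists_notin.
rewrite !inE !negb_or => /and5P[wx1 wy1 wx2 wu /andP[wv wy2]].
have vw : ~~ e v w by rewrite ev negb_or wy1.
have uw : ~~ e u w by rewrite eu negb_or wx1.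
have x1w : e x1 w by apply: ex.
have wy : e w y2 by rewrite e_sym; apply: ey.
have y1v' : e y1 v by rewrite e_sym.
have y2v' : e y2 v by rewrite e_sym.
have x2u' : e x2 u by rewrite e_sym.
have x1u' : e x1 u by rewrite e_sym.
have x2x1 : e x2 x1 by rewrite e_sym.
have c1 := same _ _ ux1 xy1 y1v'; have c2 := same _ _ ux2 xy2 y2v'.
have pcc a b d : e a b -> e b d -> a != d -> col c a b != col c b d.
  exact: proper_consecutive.
have c12 : col c u x1 != col c u x2 by rewrite [[set u; x1]]setUC pcc.
have [u1 u2 u3] : [/\ u != x1, u != x2 & u != w] by split; [exact: adj_neq | exact: adj_neq | rewrite eq_sym].
have [u4 u5] : u != y1 /\ u != y2 by split; rewrite eq_sym.
(* Of the six pairs of edges on the path, three are consecutive and differ by properness; the other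
   three are the hypotheses. *)
have long4 x z y : e u x -> e x z -> e z y -> e y v -> uniq [:: u; x; z; y; v] ->
    col c u x != col c z y -> col c u x != col c y v -> col c x z != col c y v -> False.
  move=> ux xz zy yv U d1 d2 d3; have := long x z y ux xz zy yv U; move: U.
  rewrite /= !inE !negb_or => /and5P[/and4P[_ uz _ _] /and3P[_ x_y _] /andP[_ zv] _ _].
  by rewrite d1 d2 d3 !pcc.
(* Otherwise u-x1-x2-y2-v is rainbow; for [c1'] the path is u-x2-x1-y1-v. *)
have c2' : col c x2 y2 = col c u x1.
  apply/eqP; apply: contraT => ne; case: (long4 x1 x2 y2) => //.
  - by rewrite /= !inE !negb_or u1 u2 u5 uv x12 n12 x1v n22 x2v y2v.
  - by rewrite eq_sym.
  - by rewrite -c2.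
  - by rewrite -c2 [[set u; x2]]setUC pcc.
have c1' : col c x1 y1 = col c u x2.
  apply/eqP; apply: contraT => ne; case: (long4 x2 x1 y1) => //.
  - by rewrite /= !inE !negb_or u1 u2 u4 uv [x2 == x1]eq_sym x12 n21 x2v n11 x1v y1v.
  - by rewrite eq_sym.
  - by rewrite -c1 eq_sym.
  - by rewrite -c1 [[set u; x1]]setUC pcc // 1?e_sym // eq_sym.
(* By [c2'] the colour of [ux1] occurs on [x2y2], hence not on [wy2]; by [c1'] the colour of [y2v]
   occurs on [x1y1], hence not on [x1w]. *)
case: (long4 x1 w y2) => //.
- by rewrite /= !inE !negb_or u1 u3 u5 uv [x1 == w]eq_sym wx1 n12 x1v wy2 wv y2v.
- by rewrite -c2' eq_sym [[set x2; y2]]setUC pcc // e_sym.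
- by rewrite -c2.
by rewrite -c2 -c1' eq_sym [[set x1; y1]]setUC pcc // 1?e_sym // eq_sym.
Qed.

(** * From an optimal proper colouring to the theorem *)

(** One bad pair determines enough of the graph to recolour it as a whole. The bound [k] is kept, so
    taking it to be the chromatic index gives the upper bound on prc. *)
Lemma rainbow_recolouring c k :
  colouring_with e c k -> proper_colouring e c -> connected_graph e ->
  'C(#|T| - 2, 2) + 2 <= #|edges e| ->
  (exists c', [/\ colouring_with e c' k, proper_colouring e c' & rainbow_connected e c'])
  \/ graph_iso e P4 \/ graph_iso e Z2 \/ graph_iso e G63.
Proof.
move=> ck pc con sz.
have short_connected c' : proper_colouring e c' ->
    (forall x y, x != y -> short_rainbow c' x y) -> rainbow_connected e c'.
  by move=> pc' sr x y xy; apply: short_rainbow_path => //; apply: sr.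
have [sr|] := boolP [forall x, forall y, (x != y) ==> short_rainbow c x y].
  left; exists c; split=> //; apply: short_connected => // x y xy.
  by have /forallP/(_ x)/forallP/(_ y)/implyP := sr; apply.
case/forallPn=> u /forallPn[v]; rewrite negb_imply => /andP[uv bad].
wlog ab : u v uv bad / #|N u| <= #|N v|.
  move=> wl; have [|/ltnW] := leqP #|N u| #|N v|; first exact: (wl u v).
  by apply: (wl v u); rewrite 1?eq_sym // short_rainbow_sym.
have [[a1|[a2 b2]] _ _ _] := bad_pair_structure pc con sz uv bad ab.
  have [[c' [ck' pc' sr]]|[|]] := bad_pair_one_neighbour ck pc con sz uv bad ab a1.
  - by left; exists c'; split=> //; apply: short_connected.
  - by right; left.
  - by right; right; left.
by right; right; right; apply: (bad_pair_two_neighbours pc con sz uv bad).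
Qed.

Lemma exists_chromatic_index : exists k, is_chromatic_index e k.
Proof.
have [|k [kP kmin]] := @exists_least
  (fun k => exists c, colouring_with e c k /\ proper_colouring e c).
  (* Ranking all subsets gives pairwise distinct colours, hence some proper colouring. *)
  exists #|{set T}|, (fun A => enum_rank A : nat); split=> [A _|A B _ _ AB _].
    exact: ltn_ord.
  by apply: contraNneq AB => /val_inj/enum_rank_inj->.
by exists k; split=> // k' c ck pc; apply: kmin; exists c.
Qed.

End Graph.

Theorem theorem6p3 (T : finType) (e : rel T)
  (e_sym : symmetric e) (e_irr : irreflexive e) :
  connected_graph e ->
  3 <= #|T| ->
  'C(#|T| - 2, 2) + 2 <= #|edges e| ->
  (exists k, is_prc e k /\ is_chromatic_index e k)
  \/ graph_iso e P4 \/ graph_iso e Z2 \/ graph_iso e G63.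
Proof.
move=> con _ sz; have [k chi] := exists_chromatic_index e.
have [[c [ck pc]] kmin] := chi.
have [[c' cP]|exc] := rainbow_recolouring e_sym e_irr ck pc con sz; last by right.
left; exists k; split=> //; split; first by exists c'.
(* A rainbow connected proper colouring is in particular proper, so the chromatic index bounds prc
   from below. *)
by move=> k' d dk pd _; apply: (kmin k' d).
Qed.
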